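(* Consider a Markov decision process with states $\mathcal S$, actions $\mathcal A$, transition kernel $\mathcal P$, nonnegative cost bounded above by $\overline{c_\pi}$, starting distribution $\rho$, discount factor $\gamma\in(0,1)$ and policy $\pi$, with $c_\pi(s)=\mathbb E_{a\sim\pi}\mathcal C(s,a)$ and $\mathcal P_\pi(s'\mid s)=\int_{\mathcal A}\pi(a\mid s)\mathcal P(s'\mid s,a)\,\mathrm da$. Let $\mathcal L_\pi(s)=\mathbb E_\pi[\sum_{t=0}^\infty\gamma^t c_\pi(s_t)\mid s_0=s]$ and, for constants $k,\lambda$, $\Delta\mathcal L_\pi(s)=\mathbb E_{s'\sim\mathcal P_\pi(\cdot\mid s)}\mathcal L_\pi(s')-\mathcal L_\pi(s)+k\big[\mathcal L_\pi(s)-\lambda\,\mathbb E_{s'\sim\mathcal P_\pi(\cdot\mid s)}\mathcal L_\pi(s')\big]$. Let $\mathcal U^T_\pi=\frac1T\sum_{t=0}^T\mathcal T(s\mid\rho,\pi,t)$. Suppose $M$ trajectories of length $T$ are sampled, and let $s^m_t$ denote the state of the $m$-th trajectory at timestep $t$. Then for every $\alpha>0$, $$\mathbb P\Big(\Big|\frac1{MT}\sum_{m=1}^M\sum_{t=1}^T\Delta\mathcal L_\pi(s^m_t)-\mathbb E_{s\sim\mathcal U^T_\pi}\Delta\mathcal L_\pi(s)\Big|\ge\alpha\Big)\le 2\exp\Big(-\frac{M\alpha^2(1-\gamma)^2}{((1-k\lambda)^2+(k-1)^2)\,\overline{c_\pi}^2}\Big).$$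
   Context: The state distribution is defined by $\mathcal T(s\mid\rho,\pi,0)=\rho$ and $\mathcal T(s'\mid\rho,\pi,t+1)=\int_{\mathcal S}\int_{\mathcal A}\pi(a\mid s)\mathcal P(s'\mid s,a)\,\mathrm da\,\mathcal T(s\mid\rho,\pi,t)\,\mathrm ds$. Trajectories start from $s_0\sim\rho$ and evolve under $\pi$ and $\mathcal P$. $\overline{c_\pi}$ denotes the maximum of the cost.
   Formalization: The measure U^T_π is taken as (1/T) times the sum of T(·|ρ,π,t) over t=1,…,T, matching the sampled timesteps, instead of t=0,…,T; with T+1 terms of weight 1/T the stated bound fails, for example when ΔL_π is a nonzero constant. *)

(* Defs.v *)
From HB Require Import structures.
From mathcomp Require Import all_boot all_order all_algebra.
From mathcomp Require Import all_classical all_reals all_analysis.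
Set Implicit Arguments. Unset Strict Implicit. Unset Printing Implicit Defensive.
Import Order.TTheory GRing.Theory Num.Theory.
Local Open Scope classical_set_scope.
Local Open Scope ring_scope.

Section MDP.
Context {R : realType} {dS dA : measure_display}
  {S : measurableType dS} {A : measurableType dA}.

Definition Ppi (pi : R.-pker S ~> A) (P : R.-pker (S * A) ~> S)
  : S -> {measure set S -> \bar R} := (pi \; P)%E.

Definition cpi (pi : R.-pker S ~> A) (C : S * A -> R) (s : S) : R :=
  Rintegral (pi s) [set: A] (fun a => C (s, a)).

Definition Qop (pi : R.-pker S ~> A) (P : R.-pker (S * A) ~> S)
  (f : S -> R) (s : S) : R := Rintegral (Ppi pi P s) [set: S] f.

(* t-fold iterate: (Q^t f)(s) = E[f(s_t) | s_0 = s] *)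
Fixpoint Qiter pi P (t : nat) (f : S -> R) : S -> R :=
  match t with 0 => f | t'.+1 => Qop pi P (Qiter pi P t' f) end.

Definition Lpi pi P C (gamma : R) (s : S) : R :=
  limn (fun n => \sum_(t < n) gamma ^+ t * Qiter pi P t (cpi pi C) s).

Definition DeltaL pi P C (gamma k lam : R) (s : S) : R :=
  Qop pi P (Lpi pi P C gamma) s - Lpi pi P C gamma s
  + k * (Lpi pi P C gamma s - lam * Qop pi P (Lpi pi P C gamma) s).

(* E_{s ~ T(.|rho,pi,t)} f(s), where T(.|rho,pi,0) = rho and
   T(.|rho,pi,t+1) = int P_pi(.|s) T(s|rho,pi,t) ds *)
Definition state_expect (rho : probability S R) pi P (t : nat) (f : S -> R) : R :=
  Rintegral rho [set: S] (Qiter pi P t f).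

Fixpoint chainF pi P (g : nat -> S -> R) (n : nat) : S -> R :=
  match n with
  | 0 => g 0%N
  | n'.+1 => fun s => g 0%N s * Qop pi P (chainF pi P (fun t => g t.+1) n') s
  end.

(* Probability that a Markov chain with initial law rho and kernel P_pi
   has s_t in B t for every t <= n *)
Definition path_prob (rho : probability S R) pi P (B : nat -> set S) (n : nat) : R :=
  Rintegral rho [set: S] (chainF pi P (fun t => \1_(B t)) n).

(* X m t (m < M, t <= T) are M independent trajectories (s^m_0,...,s^m_T),
   each with s_0 ~ rho and s_{t+1} ~ P_pi(. | s_t): finite-dimensional
   distributions of the family. *)
Definition iid_trajectories {dO} {Omega : measurableType dO}
  (Pr : probability Omega R) (rho : probability S R) pi P
  (M T : nat) (X : 'I_M -> nat -> Omega -> S) : Prop :=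
  (forall m t, measurable_fun [set: Omega] (X m t)) /\
  forall B : 'I_M -> nat -> set S, (forall m t, measurable (B m t)) ->
    Pr [set w | forall m t, (t <= T)%N -> B m t (X m t w)]
    = (\prod_(m < M) path_prob rho pi P (B m) T)%:E.

End MDP.

(* Main.v *)
Require Import Defs.
From HB Require Import structures.
From mathcomp Require Import all_boot all_order all_algebra.
From mathcomp Require Import all_classical all_reals all_analysis.
From mathcomp Require Import measurable_realfun.
From mathcomp Require Import ring lra.
Set Implicit Arguments. Unset Strict Implicit. Unset Printing Implicit Defensive.
Import Order.TTheory GRing.Theory Num.Theory.
Import numFieldNormedType.Exports.
Local Open Scope classical_set_scope.
Local Open Scope ring_scope.

(** Write [L] for the value function and [H := cbar / (1 - gamma)]. Since
    [0 <= L <= H], the function [DeltaL = (1 - k lam) Q L + (k - 1) L] stays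
    within [r := (|1 - k lam| + |k - 1|) H / 2] of a constant, and
    [r ^ 2 <= ((1 - k lam) ^ 2 + (k - 1) ^ 2) H ^ 2 / 2]. The [M] time averages of
    [DeltaL] along the trajectories are independent with the same mean, so the
    bound is Hoeffding's inequality. The exponential of a time average is a
    product of functions of the single states, so its expectation, the
    factorisation over trajectories and the mean are all instances of one
    formula: the expectation of a product of bounded functions of the states is
    [\prod_m rho (chainF (g m) T)]. For indicators this is the definition of
    [iid_trajectories]; it extends to bounded functions one coordinate at a time
    by linearity and uniform approximation. *)

(** * The moment generating function of a Bernoulli variable *)

Lemma is_derive_ge0_le (R : realType) (f f' : R -> R) (u : R) :
  (forall x : R, is_derive x (1 : R) f (f' x)) ->
  (forall x, 0 <= x -> 0 <= f' x) ->
  0 <= u -> f 0 <= f u.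
Proof.
move=> df f'0 u0.
apply: (@ger0_derive1_le_cc R f 0 u) => //; rewrite ?in_itv/= ?lexx ?u0//.
- move=> x; rewrite in_itv/= => /andP[x0 _].
  by rewrite derive1E derive_val f'0// ltW.
- by apply: derivable_within_continuous => x _; exact: ex_derive.
Qed.

Section bernoulli_mgf.
Variables (R : realType) (p : R).
Hypothesis p01 : 0 <= p <= 1.

Let mix (x : R) : R := (1 - p) + p * expR x.

Let mix_gt0 x : 0 < mix x.
Proof.
have /andP[p0 p1] := p01; rewrite /mix.
have := expR_gt0 x; move: p0 p1 (expR x) => p0 p1 e e0.
by have [->|pn1] := eqVneq p 1; nra.
Qed.

Let is_derive_mix (x : R) : is_derive x (1 : R) mix (p * expR x).
Proof.
rewrite /mix; apply: is_derive_eq.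
by rewrite /GRing.scale/=; ring.
Qed.

(** The derivative of [p * x + x ^+ 2 / 8 - ln (mix x)], with [p * expR x / mix x] rewritten as
    [1 - (1 - p) / mix x] so that only one term has to be differentiated again. *)
Let slope (x : R) : R := x / 4 + p - 1 + (1 - p) * (mix x)^-1.

Let slope_ge0 (u : R) : 0 <= u -> 0 <= slope u.
Proof.
move=> u0.
have -> : 0 = slope 0 by rewrite /slope /mix expR0 mulr1 subrK invr1; ring.
(* The derivative of [slope] is [1 / 4 - (1 - p) * (p * expR x) / mix x ^+ 2]. Since [mix x] is the
   sum of [1 - p] and [p * expR x], a common denominator turns it into a square. *)
pose s' (x : R) := (1 - p - p * expR x) ^+ 2 / (4 * mix x ^+ 2).
have s'0 x : 0 <= x -> 0 <= s' x.
  move=> _; apply: divr_ge0; first exact: sqr_ge0.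
  by apply: mulr_ge0; [exact: ler0n|exact: sqr_ge0].
apply: (is_derive_ge0_le _ s'0 u0) => x.
have mx0 : mix x != 0 by rewrite gt_eqF.
have dV := is_deriveV mx0 (is_derive_mix x).
rewrite /slope; apply: is_derive_eq.
rewrite /GRing.scale/= /s'.
rewrite /mix in mx0 *.
move: mx0; move: (expR x) => e mx0; by field.
Qed.

(** After taking logarithms, the difference of the two sides vanishes at [0] and has derivative
    [slope], which is nonnegative on the half-line because it too vanishes at [0] and increases. *)
Lemma bernoulli_mgf_le_ge0 (u : R) : 0 <= u ->
  (1 - p) + p * expR u <= expR (p * u + u ^+ 2 / 8).
Proof.
move=> u0; rewrite -ler_ln ?posrE ?expR_gt0 ?(mix_gt0 u)// expRK.
pose g (x : R) := p * x + x ^+ 2 / 8 - ln (mix x).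
suff : g 0 <= g u by rewrite /g /mix expR0 mulr1 subrK ln1; lra.
apply: (is_derive_ge0_le _ slope_ge0 u0) => x.
have mx0 : mix x != 0 by rewrite gt_eqF.
have dl := is_derive1_ln (mix_gt0 x).
have dc := @is_derive1_comp R (@ln R) mix x _ _ dl (is_derive_mix x).
rewrite /g; apply: is_derive_eq.
rewrite /GRing.scale/= /slope.
rewrite /mix in mx0 *.
move: mx0; move: (expR x) => e mx0; by field.
Qed.
End bernoulli_mgf.

Lemma bernoulli_mgf_le (R : realType) (p u : R) : 0 <= p <= 1 ->
  (1 - p) + p * expR u <= expR (p * u + u ^+ 2 / 8).
Proof.
move=> /andP[p0 p1]; have [u0|u0] := leP 0 u.
  by apply: bernoulli_mgf_le_ge0 => //; rewrite p0.
(* For negative [u], exchange success and failure: the case already proved applies to [1 - p] and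
   [- u], and multiplying by [expR u] restores the original expression. *)
have Nu0 : 0 <= - u by lra.
have q01 : 0 <= 1 - p <= 1 by lra.
have := bernoulli_mgf_le_ge0 q01 Nu0.
rewrite -(ler_pM2r (expR_gt0 u)) -expRD sqrrN.
rewrite mulrDl -mulrA -expRD addNr expR0.
by congr (_ <= expR _); ring.
Qed.

(** * Bounded measurable functions and their expectations *)

Section bounded_measurable.
Context {R : realType} {d : measure_display} {T : measurableType d}.
Implicit Types (f g : T -> R) (K : R).

(** The bound is kept as a parameter because the approximation argument needs linear control of a
    functional by it, and because products and chains have to carry it along. *)
Definition bmeas K f := measurable_fun [set: T] f /\ forall x, `|f x| <= K.

Lemma bmeas_cst (c : R) : bmeas `|c| (fun=> c).
Proof. by split. Qed.

Lemma bmeas_lin K1 K2 f g (a : R) : bmeas K1 f -> bmeas K2 g ->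
  bmeas (`|a| * K1 + K2) (fun x => a * f x + g x).
Proof.
move=> [mf fK] [mg gK]; split.
  by apply: measurable_funD => //; exact: measurable_funM.
move=> x; apply: (le_trans (ler_normD _ _)); rewrite normrM.
by apply: lerD => //; apply: ler_wpM2l.
Qed.

Lemma bmeasM K1 K2 f g : bmeas K1 f -> bmeas K2 g ->
  bmeas (K1 * K2) (fun x => f x * g x).
Proof.
move=> [mf fK] [mg gK]; split; first exact: measurable_funM.
by move=> x; rewrite normrM; apply: ler_pM.
Qed.

Lemma bmeas_prod (I : Type) (r : seq I) (K : I -> R) (f : I -> T -> R) :
  (forall i, bmeas (K i) (f i)) ->
  bmeas (\prod_(i <- r) K i) (fun x => \prod_(i <- r) f i x).
Proof.
move=> bf; elim: r => [|i r IH].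
  have -> : (fun x => \prod_(i <- [::]) f i x) = fun=> 1.
    by apply/funext => x; rewrite big_nil.
  by rewrite big_nil; split => // x; rewrite normr1.
have -> : (fun x => \prod_(j <- i :: r) f j x) =
    (fun x => f i x * \prod_(j <- r) f j x).
  by apply/funext => x; rewrite big_cons.
by rewrite big_cons; exact: bmeasM.
Qed.

Lemma bmeas_sum (I : Type) (r : seq I) (K : I -> R) (f : I -> T -> R) :
  (forall i, bmeas (K i) (f i)) ->
  bmeas (\sum_(i <- r) K i) (fun x => \sum_(i <- r) f i x).
Proof.
move=> bf; elim: r => [|i r IH].
  have -> : (fun x => \sum_(i <- [::]) f i x) = fun=> 0.
    by apply/funext => x; rewrite big_nil.
  by rewrite big_nil; split => // x; rewrite normr0.
have -> : (fun x => \sum_(j <- i :: r) f j x) =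
    (fun x => 1 * f i x + \sum_(j <- r) f j x).
  by apply/funext => x; rewrite big_cons mul1r.
by rewrite big_cons -[K i]mul1r -[X in X * _]normr1; exact: bmeas_lin.
Qed.

Lemma bmeas_indic (E : set T) : measurable E -> bmeas 1 (\1_E : T -> R).
Proof.
move=> mE; split; first exact: measurable_indic.
by move=> x; rewrite indicE; case: (_ \in _); rewrite ?normr0 ?normr1.
Qed.

Lemma bmeas_expR K f (s : R) : bmeas K f ->
  bmeas (expR (`|s| * K)) (fun x => expR (s * f x)).
Proof.
move=> [mf fK]; split.
  by apply: measurableT_comp => //; apply: measurable_funM.
move=> x; rewrite ger0_norm ?expR_ge0// ler_expR.
by rewrite (le_trans (ler_norm _))// normrM ler_wpM2l.
Qed.

Lemma bmeas_center f (c r : R) : measurable_fun [set: T] f ->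
  (forall x, `|f x - c| <= r) -> bmeas (`|c| + r) f.
Proof.
move=> mf fr; split=> // x.
by rewrite -(subrK c (f x)) addrC (le_trans (ler_normD _ _))// lerD2l.
Qed.

(* Halving: on [0, K] subtract [K / 2 * \1_E] with [E := {K / 2 < f}]; the rest
   lies in [0, K / 2], and the functional does not see the part removed. *)
Lemma linear_functional_eq0 (Phi : (T -> R) -> R) (c : R) :
  (forall a f g K1 K2, bmeas K1 f -> bmeas K2 g ->
    Phi (fun x => a * f x + g x) = a * Phi f + Phi g) ->
  (forall f K, bmeas K f -> `|Phi f| <= c * K) ->
  (forall E, measurable E -> Phi \1_E = 0) ->
  forall f K, bmeas K f -> Phi f = 0.
Proof.
move=> PhiL Phib Phi1.
have half n : forall K f, measurable_fun [set: T] f ->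
    (forall x, 0 <= f x <= K) -> `|Phi f| <= c * K * 2^-1 ^+ n.
  elim: n => [|n IH] K f mf fK.
    rewrite expr0 mulr1; apply: Phib; split=> // x.
    by have /andP[f0 fx] := fK x; rewrite ger0_norm.
  pose E := [set x | K / 2 < f x].
  have mE : measurable E.
    rewrite -[E]setTI; exact: measurable_fun_ltr.
  pose h x := (- (K / 2)) * \1_E x + f x.
  have fE : f = (fun x => (K / 2) * \1_E x + h x).
    by apply/funext => x; rewrite /h; ring.
  have bf : bmeas K f.
    by split=> // x; have /andP[f0 fx] := fK x; rewrite ger0_norm.
  have bh : bmeas (`|- (K / 2)| * 1 + K) h.
    by apply: bmeas_lin => //; exact: bmeas_indic.
  rewrite fE (PhiL _ _ _ _ _ (bmeas_indic mE) bh) Phi1// mulr0 add0r.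
  have := IH (K / 2) h bh.1; rewrite exprS.
  have -> : c * (K / 2) * 2^-1 ^+ n = c * K * (2^-1 * 2^-1 ^+ n) by ring.
  apply => x; have := fK x; rewrite /h indicE.
  have [xE|/negP] := boolP (x \in E).
    by have {}xE : K / 2 < f x := set_mem xE; rewrite mulr1; lra.
  by rewrite inE /E /= => /negP; rewrite -leNgt mulr0 add0r => xE; lra.
have pos K f : measurable_fun [set: T] f -> (forall x, 0 <= f x <= K) -> Phi f = 0.
  move=> mf fK; apply/eqP; rewrite -normr_le0; apply/ler_addgt0Pr => e e0.
  rewrite add0r.
  have /cvgrPdist_lt/(_ e e0)[n _ /(_ n (leqnn n))/=] :
      (c * K * 2^-1 ^+ n @[n --> \oo] --> (0 : R)).
    have := @cvg_geometric R (c * K) 2^-1; apply.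
    by rewrite gtr0_norm ?invr_gt0// invf_lt1 ?ltr1n.
  rewrite sub0r normrN => /ltW; apply: le_trans.
  by rewrite (le_trans _ (ler_norm _))// half.
(* [Phi] vanishes on constants, so adding [K] to [f] does not change its value and brings the
   function into [[0, 2 * K]]. *)
move=> f K bf.
have b1 : bmeas 1 (\1_[set: T] : T -> R) by exact: bmeas_indic.
have := PhiL K _ _ _ _ b1 bf; rewrite Phi1// mulr0 add0r => <-.
have bg := bmeas_lin K b1 bf.
apply: (@pos (2 * K)) => [|x]; first exact: bg.1.
rewrite indicT mulr1; have := bf.2 x; rewrite ler_norml; lra.
Qed.

Section expectation.
Variable mu : {measure set T -> \bar R}.
Hypothesis mu1 : mu [set: T] = 1%E.
Local Notation E f := (Rintegral mu [set: T] f).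

Lemma bmeas_integrable K f : bmeas K f -> mu.-integrable [set: T] (EFin \o f).
Proof.
move=> [mf fK]; apply: measurable_bounded_integrable => //.
  by rewrite [ltLHS]mu1 ltry.
exists K; split; first exact: num_real.
by move=> M KM x _; apply: le_trans (fK x) (ltW KM).
Qed.

Lemma E_cst (c : R) : E (fun=> c) = c.
Proof. by rewrite Rintegral_cst// [mu _]mu1 mulr1. Qed.

Lemma E_lin K1 K2 f g (a : R) : bmeas K1 f -> bmeas K2 g ->
  E (fun x => a * f x + g x) = a * E f + E g.
Proof.
move=> bf bg; have ibf := bmeas_integrable bf.
rewrite RintegralD ?RintegralZl//; last exact: bmeas_integrable bg.
have b0 := bmeas_cst 0; have := bmeas_lin a bf b0.
under eq_fun do rewrite addr0.
exact: bmeas_integrable.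
Qed.

Lemma le_E K1 K2 f g : bmeas K1 f -> bmeas K2 g -> (forall x, f x <= g x) ->
  E f <= E g.
Proof.
by move=> bf bg fg; apply: le_Rintegral => //;
  [exact: bmeas_integrable bf|exact: bmeas_integrable bg].
Qed.

Lemma E_norm_le K f : bmeas K f -> `|E f| <= K.
Proof.
move=> bf; have fK x := bf.2 x.
have fl x : - K <= f x by have := fK x; rewrite ler_norml => /andP[].
have fu x : f x <= K by rewrite (le_trans (ler_norm _)).
have := le_E (bmeas_cst (- K)) bf fl; have := le_E bf (bmeas_cst K) fu.
by rewrite !E_cst ler_norml => -> ->.
Qed.

Lemma E_sum (I : Type) (r : seq I) (K : I -> R) (f : I -> T -> R) :
  (forall i, bmeas (K i) (f i)) ->
  E (fun x => \sum_(i <- r) f i x) = \sum_(i <- r) E (f i).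
Proof.
move=> bf; elim: r => [|i r IH].
  under eq_Rintegral do rewrite big_nil.
  by rewrite big_nil E_cst.
under eq_Rintegral do rewrite big_cons -[f i _]mul1r.
rewrite big_cons -IH (E_lin _ (bf i) (bmeas_sum r bf)) mul1r//.
Qed.

Lemma E_indic (A : set T) : measurable A -> (E \1_A)%:E = mu A.
Proof.
move=> mA; rewrite /Rintegral integral_indic// setIT fineK//.
by rewrite ge0_fin_numE// (le_lt_trans (le_measure mu _ _ (@subsetT _ A)))// ?inE//
  [ltLHS]mu1 ltry.
Qed.

End expectation.
End bounded_measurable.

(** * The transition operator and chains of factors along a path *)

Section markov_operator.
Context {R : realType} {dS dA : measure_display}
  {S : measurableType dS} {A : measurableType dA}.
Variables (pi : R.-pker S ~> A) (P : R.-pker (S * A) ~> S).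
Implicit Types (f g : S -> R) (K : R).

Lemma Ppi_setT s : Ppi pi P s [set: S] = 1%E.
Proof.
rewrite /Ppi /mkcomp /= /kcomp.
under eq_integral do rewrite prob_kernel.
by rewrite integral_cst// mul1e prob_kernel.
Qed.

Lemma Qop_bmeas K f : bmeas K f -> bmeas K (Qop pi P f).
Proof.
move=> bf; split; last by move=> s; apply: E_norm_le => //; exact: Ppi_setT.
(* Measurability of a kernel integral is invoked for a nonnegative integrand, so [f] is shifted up
   by [K] and the constant is subtracted after integration. *)
have bg := bmeas_lin 1 (bmeas_cst K) bf.
have -> : Qop pi P f = fun s =>
    (- K) + fine (\int[Ppi pi P s]_x (1 * K + f x)%:E)%E.
  apply/funext => s; rewrite -/(Rintegral _ _ _).
  rewrite (E_lin (Ppi_setT s) 1 (bmeas_cst K) bf) (E_cst (Ppi_setT s)) /Qop.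
  by rewrite mul1r addKr.
apply: measurable_funD => //; apply: measurableT_comp => //.
apply: measurable_fun_integral_kernel.
- exact: measurable_fun_mkcomp_sfinite.
- by move=> x; have := bf.2 x; rewrite lee_fin mul1r ler_norml; lra.
- by apply/measurable_EFinP; exact: bg.1.
Qed.

Lemma Qop_lin K1 K2 f g (a : R) : bmeas K1 f -> bmeas K2 g ->
  Qop pi P (fun x => a * f x + g x) = fun s => a * Qop pi P f s + Qop pi P g s.
Proof. by move=> bf bg; apply/funext => s; exact: (E_lin (Ppi_setT s) a bf bg). Qed.

Lemma Qop_cst (c : R) : Qop pi P (fun=> c) = fun=> c.
Proof. by apply/funext => s; exact: (E_cst (Ppi_setT s)). Qed.

Lemma Qiter_bmeas K t f : bmeas K f -> bmeas K (Qiter pi P t f).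
Proof. by elim: t => //= t IH bf; apply: Qop_bmeas; exact: IH. Qed.

Lemma Qiter_ge0 t f : (forall s, 0 <= f s) -> forall s, 0 <= Qiter pi P t f s.
Proof. by move=> f0; elim: t => //= t IH s; apply: Rintegral_ge0. Qed.

Lemma chainF_bmeas (K : nat -> R) (g : nat -> S -> R) n :
  (forall t, bmeas (K t) (g t)) ->
  bmeas (\prod_(t < n.+1) K t) (chainF pi P g n).
Proof.
elim: n K g => [|n IH] K g bg; first by rewrite big_ord1.
rewrite big_ord_recl; apply: bmeasM => //; apply: Qop_bmeas.
by apply: (IH (fun t => K t.+1)).
Qed.

Lemma eq_chainF (g h : nat -> S -> R) n : (forall t, (t <= n)%N -> g t = h t) ->
  chainF pi P g n = chainF pi P h n.
Proof.
elim: n g h => [|n IH] g h gh /=; first exact: gh.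
by rewrite gh// (IH _ (fun t => h t.+1))// => t tn; exact: gh.
Qed.

Lemma chainF_cst1 n : chainF pi P (fun _ _ => 1) n = fun=> 1.
Proof.
by elim: n => //= n ->; apply/funext => s; rewrite Qop_cst mulr1.
Qed.

Definition upd {U : Type} (g : nat -> U) (p : nat) (f : U) : nat -> U :=
  fun t => if t == p then f else g t.

(** Factors [1] after time [p] collapse because the operator fixes constants; those before [p] leave
    [p] bare applications of the operator. Marginals of a single state thus become instances of the
    product formula. *)
Lemma chainF_upd1 p f n : (p <= n)%N ->
  chainF pi P (upd (fun _ _ => 1) p f) n = Qiter pi P p f.
Proof.
elim: n p => [|n IH] [|p]//= pn; apply/funext => s.
  by rewrite -/(chainF pi P (fun _ _ => 1)) chainF_cst1 Qop_cst mulr1.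
by rewrite mul1r -(IH p).
Qed.

Lemma bmeas_upd (K : nat -> R) (g : nat -> S -> R) p K' f :
  (forall t, bmeas (K t) (g t)) -> bmeas K' f ->
  forall t, bmeas (upd K p K' t) (upd g p f t).
Proof. by move=> bg bf t; rewrite /upd; case: eqP. Qed.

(** The factors sit inside nested linear operators, so [chainF] is linear in each of them
    separately. This is what allows one coordinate to be generalised while the others stay fixed. *)
Lemma chainF_lin (K : nat -> R) (g : nat -> S -> R) p K1 K2 f h (a : R) n :
  (forall t, bmeas (K t) (g t)) -> bmeas K1 f -> bmeas K2 h -> (p <= n)%N ->
  chainF pi P (upd g p (fun x => a * f x + h x)) n =
  fun s => a * chainF pi P (upd g p f) n s + chainF pi P (upd g p h) n s.
Proof.
move=> bg bf bh; elim: n p K g bg => [|n IH] [|p] K g bg//= pn; apply/funext => s.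
  by rewrite mulrDl mulrA.
have bg' t := bg t.+1.
have bF := chainF_bmeas n (bmeas_upd p bg' bf).
have bH := chainF_bmeas n (bmeas_upd p bg' bh).
have := IH p _ _ bg' pn.
rewrite /upd /= in bF bH * => ->.
by rewrite (Qop_lin a bF bH) mulrDr; congr (_ + _); ring.
Qed.

End markov_operator.

(** * Expectations of products over the states of independent trajectories *)

Lemma bmeas_comp (R : realType) (d1 d2 : measure_display)
    (T1 : measurableType d1) (T2 : measurableType d2) (K : R) (f : T2 -> R)
    (Y : T1 -> T2) :
  measurable_fun [set: T1] Y -> bmeas K f -> bmeas K (fun w => f (Y w)).
Proof. by move=> mY [mf fK]; split => //; exact: measurableT_comp. Qed.

Section trajectories.
Context {R : realType} {dS dA dO : measure_display} {S : measurableType dS}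
  {A : measurableType dA} {Omega : measurableType dO}.
Variables (pi : R.-pker S ~> A) (P : R.-pker (S * A) ~> S)
  (rho : probability S R) (M T : nat) (Pr : probability Omega R)
  (X : 'I_M -> nat -> Omega -> S).
Hypothesis iidX : iid_trajectories Pr rho pi P T X.

Local Notation EO f := (Rintegral Pr [set: Omega] f).
Local Notation Erho f := (Rintegral rho [set: S] f).
Local Notation idx := ('I_M * 'I_T.+1)%type.

Let Pr1 : (Pr : {measure set Omega -> \bar R}) [set: Omega] = 1%E.
Proof. exact: probability_setT. Qed.

Let rho1 : (rho : {measure set S -> \bar R}) [set: S] = 1%E.
Proof. exact: probability_setT. Qed.

Let prodX (g : 'I_M -> nat -> S -> R) (w : Omega) : R :=
  \prod_(i : idx) g i.1 i.2 (X i.1 i.2 w).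

Let prodX_bmeas (K : 'I_M -> nat -> R) (g : 'I_M -> nat -> S -> R) :
  (forall m t, bmeas (K m t) (g m t)) ->
  bmeas (\prod_(i : idx) K i.1 i.2) (prodX g).
Proof.
move=> bg; apply: (@bmeas_prod _ _ _ _ _ (fun i : idx => K i.1 i.2)) => i.
by apply: bmeas_comp => //; exact: iidX.1.
Qed.

(** The base case: a product of indicators is the indicator of the event [F], whose probability
    [iid_trajectories] prescribes. Nothing is asked of [g] after time [T], since neither side reads
    it there. *)
Let prodX_indic (B : 'I_M -> nat -> set S) (g : 'I_M -> nat -> S -> R) :
  (forall m t, measurable (B m t)) ->
  (forall m t, (t <= T)%N -> g m t = \1_(B m t)) ->
  EO (prodX g) = \prod_(m < M) Erho (chainF pi P (g m) T).
Proof.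
move=> mB gB.
pose F := [set w | forall m t, (t <= T)%N -> B m t (X m t w)].
pose g' m t : S -> R := \1_(B m t).
have gg' : prodX g = prodX g'.
  apply/funext => w; apply: eq_bigr => -[m t] _ /=.
  by rewrite gB// -ltnS.
have FE : prodX g' = \1_F.
  apply/funext => w; rewrite indicE; have [wF|wF] := boolP (w \in F).
    rewrite /prodX big1// => -[m t] _; rewrite /g' indicE mem_set//=.
    by move/set_mem : wF; apply; rewrite -ltnS.
  have : ~ F w by move/mem_set => wF'; rewrite wF' in wF.
  move=> /existsNP[m /existsNP[t /not_implyP[tT nB]]].
  rewrite /prodX (bigD1 (m, inord t : 'I_T.+1))//=.
  by rewrite inordK// /g' indicE memNset// mul0r.
(* Measurability of [F] is read off from its indicator, which equals the measurable function
   [prodX g']. *)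
have mF : measurable F.
  apply/(@measurable_indicP _ _ R); rewrite -FE.
  exact: (prodX_bmeas (fun m t => bmeas_indic (mB m t))).1.
apply: EFin_inj; rewrite gg' FE (E_indic Pr1 mF); apply: etrans (iidX.2 B mB) _.
congr (_%:E); apply: eq_bigr => m _; rewrite /path_prob.
by congr (Rintegral _ _ _); apply: eq_chainF => t tT; rewrite gB.
Qed.

Let updg (g : 'I_M -> nat -> S -> R) (p : idx) f m :=
  if m == p.1 then upd (g m) p.2 f else g m.

Let prodX_upd g p f : prodX (updg g p f) = fun w => f (X p.1 p.2 w) *
  \prod_(i <- [seq i <- index_enum idx | i != p]) g i.1 i.2 (X i.1 i.2 w).
Proof.
apply/funext => w; rewrite /prodX (bigD1 p)//= big_filter; congr (_ * _).
  by rewrite /updg /upd !eqxx.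
apply: eq_bigr => -[m t] ip; rewrite /updg /upd /=.
case: (eqVneq m p.1) => // mp; case: (eqVneq (t : nat) p.2) => // tp.
by move: ip; case/negP; apply/eqP; case: p mp tp => a b /= -> /val_inj ->.
Qed.

Let prod_chainF_upd g p f :
  \prod_(m < M) Erho (chainF pi P (updg g p f m) T) =
  Erho (chainF pi P (upd (g p.1) p.2 f) T) *
  \prod_(m < M | m != p.1) Erho (chainF pi P (g m) T).
Proof.
rewrite (bigD1 p.1)//= /updg eqxx; congr (_ * _).
by apply: eq_bigr => m /negPf ->.
Qed.

(** Induction on a list [l] outside which every factor is an indicator. For its head [p], the
    difference [Phi] of the two sides, as a function of the factor at [p] alone, is linear, bounded,
    and zero on indicators by the induction hypothesis; hence [linear_functional_eq0] makes it
    zero. *)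
Let prodX_E_aux (l : seq idx) :
  forall (K : 'I_M -> nat -> R) (g : 'I_M -> nat -> S -> R),
  (forall m t, bmeas (K m t) (g m t)) ->
  (forall i : idx, i \notin l -> exists2 B, measurable B & g i.1 i.2 = \1_B) ->
  EO (prodX g) = \prod_(m < M) Erho (chainF pi P (g m) T).
Proof.
elim: l => [|p l IH] K g bg gl.
  (* The hypothesis supplies sets only for times up to [T]; later times receive the filler
     [setT]. *)
  have /choice[B BP] : forall i : 'I_M * nat, exists B : set S,
      measurable B /\ ((i.2 <= T)%N -> g i.1 i.2 = \1_B).
    move=> [m t] /=; have [tT|tT] := leqP t T; last by exists setT.
    have [B mB gB] := gl (m, inord t) isT.
    by exists B; split=> // _; move: gB => /=; rewrite inordK.
  apply: (@prodX_indic (fun m t => B (m, t))) => [m t|m t].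
    exact: (BP (m, t)).1.
  exact: (BP (m, t)).2.
pose Phi f := EO (prodX (updg g p f)) -
  \prod_(m < M) Erho (chainF pi P (updg g p f m) T).
pose r := [seq i <- index_enum idx | i != p].
pose Kr := \prod_(i <- r) K i.1 i.2.
have brest : bmeas Kr (fun w => \prod_(i <- r) g i.1 i.2 (X i.1 i.2 w)).
  apply: (@bmeas_prod _ _ _ _ _ (fun i : idx => K i.1 i.2)) => i.
  by apply: bmeas_comp => //; exact: iidX.1.
pose c' := \prod_(m < M | m != p.1) Erho (chainF pi P (g m) T).
have p2T : (p.2 <= T)%N by rewrite -ltnS.
have bupd K' f := @bmeas_upd _ _ _ (K p.1) (g p.1) p.2 K' f (bg p.1).
have bX f K' : bmeas K' f -> bmeas (K' * Kr) (prodX (updg g p f)).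
  move=> bf; rewrite prodX_upd; apply: bmeasM => //.
  by apply: bmeas_comp => //; exact: iidX.1.
have PhiL a f h K1 K2 : bmeas K1 f -> bmeas K2 h ->
    Phi (fun x => a * f x + h x) = a * Phi f + Phi h.
  move=> bf bh; rewrite /Phi !prod_chainF_upd.
  rewrite (chainF_lin pi P a (bg p.1) bf bh p2T).
  rewrite (E_lin rho1 a (chainF_bmeas pi P T (bupd _ _ bf))
    (chainF_bmeas pi P T (bupd _ _ bh))).
  have -> : prodX (updg g p (fun x => a * f x + h x)) =
     fun w => a * prodX (updg g p f) w + prodX (updg g p h) w.
    by rewrite !prodX_upd; apply/funext => w; ring.
  by rewrite (E_lin Pr1 a (bX _ _ bf) (bX _ _ bh)); ring.
(* The first summand controls the expectation over [Omega], the second the product of chain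
   expectations; in each, the bound of the varying factor has been taken out. *)
pose c := Kr + \prod_(t < T.+1 | t != p.2) K p.1 t * `|c'|.
have Phib f K' : bmeas K' f -> `|Phi f| <= c * K'.
  move=> bf; apply: (le_trans (ler_normB _ _)).
  rewrite /c mulrDl; apply: lerD.
    by rewrite mulrC (E_norm_le Pr1 (bX _ _ bf)).
  rewrite prod_chainF_upd normrM -/c' -mulrA [_ * K']mulrC mulrA.
  apply: ler_wpM2r => //.
  have := E_norm_le rho1 (chainF_bmeas pi P T (bupd _ _ bf)).
  rewrite (bigD1 p.2)//=.
  have -> : upd (K p.1) p.2 K' p.2 = K' by rewrite /upd eqxx.
  rewrite mulrC (eq_bigr (fun t : 'I_T.+1 => K p.1 t))// => t.
  by rewrite -val_eqE /upd /= => /negPf ->.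
have Phi1 E : measurable E -> Phi \1_E = 0.
  move=> mE; apply/eqP; rewrite subr_eq0; apply/eqP.
  apply: (IH (fun m => if m == p.1 then upd (K m) p.2 1 else K m)) => [m t|i il].
    rewrite /updg; case: eqP => // _.
    by apply: bmeas_upd => //; exact: bmeas_indic.
  rewrite /updg /upd; case: (eqVneq i.1 p.1) => [i1|i1].
    case: (eqVneq (i.2 : nat) p.2) => [i2|i2]; first by exists E.
    by apply: gl; rewrite inE negb_or il andbT; apply: contraNneq i2 => ->.
  by apply: gl; rewrite inE negb_or il andbT; apply: contraNneq i1 => ->.
have := linear_functional_eq0 PhiL Phib Phi1 (bg p.1 p.2).
have -> : Phi (g p.1 p.2) =
    EO (prodX g) - \prod_(m < M) Erho (chainF pi P (g m) T).
  rewrite /Phi (_ : updg g p (g p.1 p.2) = g)//.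
  apply/funext => m; apply/funext => t; rewrite /updg /upd.
  by case: eqP => // ->; case: eqP => // ->.
by move/eqP; rewrite subr_eq0 => /eqP.
Qed.

Lemma trajectories_E_prod (K : 'I_M -> nat -> R) (g : 'I_M -> nat -> S -> R) :
  (forall m t, bmeas (K m t) (g m t)) ->
  EO (fun w => \prod_(m < M) \prod_(t < T.+1) g m t (X m t w)) =
  \prod_(m < M) Erho (chainF pi P (g m) T).
Proof.
move=> bg; rewrite -(prodX_E_aux (l := index_enum idx) bg).
  congr (Rintegral _ _ _); apply/funext => w.
  by rewrite (pair_bigA _ (fun m (t : 'I_T.+1) => g m t (X m t w))).
by move=> i; rewrite mem_index_enum.
Qed.

(** Putting the factor [1] on all other trajectories makes their chains integrate to [1]. *)
Lemma trajectory_E_prod (m0 : 'I_M) (K : nat -> R) (g : nat -> S -> R) :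
  (forall t, bmeas (K t) (g t)) ->
  EO (fun w => \prod_(t < T.+1) g t (X m0 t w)) = Erho (chainF pi P g T).
Proof.
move=> bg.
pose g' m := if m == m0 then g else fun _ _ => 1.
pose K' m := if m == m0 then K else fun _ => `|1|.
have bg' m t : bmeas (K' m t) (g' m t).
  by rewrite /K' /g'; case: eqP => // _; exact: bmeas_cst.
have := trajectories_E_prod bg'.
rewrite [RHS](bigD1 m0)//= [X in _ * X]big1 ?mulr1.
  rewrite {2}/g' eqxx => <-; congr (Rintegral _ _ _); apply/funext => w.
  rewrite (bigD1 m0)//= [X in _ * X]big1 ?mulr1; first by rewrite /g' eqxx.
  by move=> m /negPf mm0; rewrite big1// /g' mm0.
by move=> m /negPf mm0; rewrite /g' mm0 chainF_cst1 E_cst.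
Qed.

Lemma trajectory_E_state (m0 : 'I_M) K (f : S -> R) (t : nat) : (t <= T)%N ->
  bmeas K f -> EO (fun w => f (X m0 t w)) = state_expect rho pi P t f.
Proof.
move=> tT bf; rewrite /state_expect -(chainF_upd1 pi P f tT).
have b1 (_ : nat) : bmeas `|1 : R| (fun _ : S => 1 : R) by exact: bmeas_cst.
rewrite -(trajectory_E_prod m0 (bmeas_upd t b1 bf)).
congr (Rintegral _ _ _); apply/funext => w.
rewrite (bigD1 (Ordinal (tT : (t < T.+1)%N)))//= big1 ?mulr1.
  by rewrite /upd eqxx.
by move=> i; rewrite -val_eqE /= /upd => /negPf ->.
Qed.

(** Independence and equality in law, in the form needed for moment generating functions. *)
Lemma trajectories_E_indep (K : nat -> R) (g : nat -> S -> R) (m0 : 'I_M) :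
  (forall t, bmeas (K t) (g t)) ->
  EO (fun w => \prod_(m < M) \prod_(t < T.+1) g t (X m t w)) =
  (EO (fun w => \prod_(t < T.+1) g t (X m0 t w))) ^+ M.
Proof.
move=> bg; rewrite (trajectories_E_prod (fun=> bg)) (trajectory_E_prod m0 bg).
by rewrite prodr_const card_ord.
Qed.

End trajectories.

(** * Hoeffding's lemma for a bounded variable *)

Lemma expR_chord (R : realType) (x y q : R) : 0 <= q <= 1 ->
  expR ((1 - q) * x + q * y) <= (1 - q) * expR x + q * expR y.
Proof.
move=> /andP[q0 q1]; set z := _ * x + _.
(* Convexity through the tangent at the intermediate point [z]: in the weighted sum of the two
   tangent inequalities the linear terms cancel. *)
have tangent u : expR z * (1 + (u - z)) <= expR u.
  have -> : expR u = expR z * expR (u - z) by rewrite -expRD addrC subrK.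
  by rewrite ler_wpM2l ?expR_ge0 ?expR_ge1Dx.
have q1' : 0 <= 1 - q by rewrite subr_ge0.
have := lerD (ler_wpM2l q1' (tangent x)) (ler_wpM2l q0 (tangent y)).
apply: le_trans; rewrite le_eqVlt; apply/orP; left; apply/eqP.
by rewrite /z; ring.
Qed.

(** On [[c - r, c + r]] the exponential lies below its chord, and the expectation of the chord
    depends on [Y] only through its mean. That value is the one for a two-point variable taking
    [c + r] with probability [p], so the Bernoulli bound applies with [u = s * (r * 2)], where
    [u ^+ 2 / 8] is [s ^+ 2 * r ^+ 2 / 2]. *)
Lemma hoeffding_mgf (R : realType) (d : measure_display) (T : measurableType d)
    (mu : {measure set T -> \bar R}) (Y : T -> R) (c r s : R) :
  mu [set: T] = 1%E -> measurable_fun [set: T] Y -> 0 < r ->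
  (forall x, `|Y x - c| <= r) ->
  Rintegral mu [set: T] (fun x => expR (s * Y x)) <=
  expR (s * Rintegral mu [set: T] Y + s ^+ 2 * r ^+ 2 / 2).
Proof.
move=> mu1 mY r0 Yr; set EY := Rintegral mu _ Y.
have r2 : r * 2 != 0 by rewrite mulf_neq0 ?gt_eqF.
have Yl x : c - r <= Y x <= c + r by have := Yr x; rewrite ler_norml; lra.
have bY := bmeas_center mY Yr.
have bYc := bmeas_lin 1 bY (bmeas_cst (- c)).
have bYc' : bmeas r (fun x => 1 * Y x + - c).
  by split; [exact: bYc.1|move=> x; rewrite mul1r].
have EYr : `|EY - c| <= r.
  have := E_norm_le mu1 bYc'.
  by rewrite (E_lin mu1 1 bY (bmeas_cst (- c))) (E_cst mu1) mul1r.
pose p := (EY - c + r) / (r * 2).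
have p01 (y : R) : `|y - c| <= r -> 0 <= (y - c + r) / (r * 2) <= 1.
  move=> yr; have r20 : 0 < r * 2 by rewrite mulr_gt0.
  rewrite divr_ge0 ?ler_pdivrMr// ?(ltW r20)//;
    by move: yr; rewrite ler_norml; lra.
pose a := s * (c - r); pose b := s * (c + r).
(* Slope and intercept of the chord through the endpoints of the interval. *)
pose k1 := (expR b - expR a) / (r * 2).
pose k0 := expR a - (c - r) * k1.
have chord (y : R) : (1 - (y - c + r) / (r * 2)) * expR a +
    (y - c + r) / (r * 2) * expR b = k1 * y + k0.
  by rewrite /k0 /k1; field; rewrite gt_eqF.
have le1 : Rintegral mu [set: T] (fun x => expR (s * Y x)) <= k1 * EY + k0.
  rewrite -[X in _ + X](E_cst mu1) -(E_lin mu1 k1 bY (bmeas_cst k0)).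
  apply: (le_E mu1 (bmeas_expR s bY) (bmeas_lin k1 bY (bmeas_cst k0))) => x.
  rewrite -chord; apply: le_trans (expR_chord _ _ (p01 _ (Yr x))).
  rewrite ler_expR le_eqVlt; apply/orP; left; apply/eqP.
  by rewrite /a /b; field; rewrite gt_eqF.
apply: (le_trans le1); rewrite -chord -/p.
have -> : b = a + s * (r * 2) by rewrite /a /b; ring.
rewrite [expR (a + _)]expRD.
have h := bernoulli_mgf_le (s * (r * 2)) (p01 _ EYr); rewrite -/p in h.
rewrite -(ler_pM2l (expR_gt0 a)) -expRD in h.
have -> : (1 - p) * expR a + p * (expR a * expR (s * (r * 2))) =
  expR a * (1 - p + p * expR (s * (r * 2))) by ring.
apply: (le_trans h); rewrite ler_expR le_eqVlt; apply/orP; left; apply/eqP.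
by rewrite /a /p; field; rewrite gt_eqF.
Qed.

(** * Bounds and measurability of the value function and of [DeltaL] *)

Section value_function.
Context {R : realType} {dS dA : measure_display}
  {S : measurableType dS} {A : measurableType dA}.
Variables (pi : R.-pker S ~> A) (P : R.-pker (S * A) ~> S) (C : S * A -> R)
  (gamma cbar : R).
Hypotheses (mC : measurable_fun [set: S * A] C) (C0 : forall sa, 0 <= C sa)
  (Cbar : forall sa, C sa <= cbar) (gamma01 : 0 < gamma < 1).

Lemma cpi_ge0 s : 0 <= cpi pi C s.
Proof. by apply: Rintegral_ge0. Qed.

Lemma cpi_bmeas : bmeas cbar (cpi pi C).
Proof.
split.
  apply: measurableT_comp => //.
  apply: (measurable_fun_integral_sfinite_kernel (EFin \o C)).
    by move=> t; rewrite lee_fin.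
  exact/measurable_EFinP.
move=> s; rewrite /cpi; apply: E_norm_le; first exact: prob_kernel.
split.
  by apply: measurableT_comp => //; exact: measurable_pair1.
by move=> a; rewrite ger0_norm.
Qed.

Let partial (s : S) (n : nat) : R :=
  \sum_(t < n) gamma ^+ t * Qiter pi P t (cpi pi C) s.

Let partial_bnd s n : partial s n <= cbar / (1 - gamma).
Proof.
have /andP[g0 g1] := gamma01.
have cbar0 : 0 <= cbar by apply: le_trans (cpi_bmeas.2 s); exact: normr_ge0.
apply: le_trans (@geometric_le_lim R n cbar gamma cbar0 g0 _); last first.
  by rewrite gtr0_norm.
rewrite seriesEord /= /partial; apply: ler_sum => t _.
rewrite /geometric /= mulrC ler_wpM2r ?exprn_ge0 ?(ltW g0)//.
by rewrite (le_trans (ler_norm _)) ?(Qiter_bmeas pi P t cpi_bmeas).2.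
Qed.

Let partial_cvg s : cvgn (partial s).
Proof.
have /andP[g0 g1] := gamma01.
apply: nondecreasing_is_cvgn; last first.
  by exists (cbar / (1 - gamma)) => _ [n _ <-]; exact: partial_bnd.
apply/nondecreasing_seqP => n; rewrite /partial big_ord_recr /= lerDl.
by rewrite mulr_ge0 ?exprn_ge0 ?(ltW g0)//; apply: Qiter_ge0; exact: cpi_ge0.
Qed.

Lemma Lpi_ge0 s : 0 <= Lpi pi P C gamma s.
Proof.
have /andP[g0 g1] := gamma01.
apply: limr_ge; first exact: partial_cvg.
apply: nearW => n; apply: sumr_ge0 => t _.
by rewrite mulr_ge0 ?exprn_ge0 ?(ltW g0)//; apply: Qiter_ge0; exact: cpi_ge0.
Qed.

Lemma Lpi_bmeas : bmeas (cbar / (1 - gamma)) (Lpi pi P C gamma).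
Proof.
split.
  apply: (@measurable_fun_cvg _ _ R [set: S] (fun n s => partial s n)) => [n|s _].
    have bt (t : 'I_n) := bmeas_lin (gamma ^+ t)
      (Qiter_bmeas pi P t cpi_bmeas) (bmeas_cst 0).
    have [] := bmeas_sum (index_enum 'I_n) bt.
    by under eq_fun do under eq_bigr do rewrite addr0.
  exact: partial_cvg.
move=> s; rewrite ger0_norm ?Lpi_ge0//.
by apply: limr_le; [exact: partial_cvg|apply: nearW => n; exact: partial_bnd].
Qed.

(** Both the value function and its image under the operator lie in [[0, H]], hence within [H / 2]
    of the midpoint. Centring there, instead of at [0], halves the radius and gains a factor [4] in
    the exponent. *)
Lemma DeltaL_center k lam s (H := cbar / (1 - gamma)) :
  `|DeltaL pi P C gamma k lam s - (1 - k * lam + (k - 1)) * H / 2| <=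
  (`|1 - k * lam| + `|k - 1|) * H / 2.
Proof.
have mid (y : R) : 0 <= y -> `|y| <= H -> `|y - H / 2| <= H / 2.
  by move=> y0; rewrite ger0_norm// => yH; rewrite ler_norml; lra.
have l1 := mid _ (Lpi_ge0 s) (Lpi_bmeas.2 s).
have q1 : `|Qop pi P (Lpi pi P C gamma) s - H / 2| <= H / 2.
  apply: mid; last exact: (Qop_bmeas pi P Lpi_bmeas).2.
  by apply: Rintegral_ge0 => x _; exact: Lpi_ge0.
rewrite /DeltaL; move: (Lpi _ _ _ _ _) (Qop _ _ _ _) l1 q1 => l q l1 q1.
have -> : q - l + k * (l - lam * q) - (1 - k * lam + (k - 1)) * H / 2 =
  (1 - k * lam) * (q - H / 2) + (k - 1) * (l - H / 2) by field.
rewrite (le_trans (ler_normD _ _))// !normrM.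
have -> : (`|1 - k * lam| + `|k - 1|) * H / 2 =
  `|1 - k * lam| * (H / 2) + `|k - 1| * (H / 2) by ring.
by apply: lerD; apply: ler_wpM2l.
Qed.

Lemma DeltaL_measurable k lam :
  measurable_fun [set: S] (DeltaL pi P C gamma k lam).
Proof.
have [mL _] := Lpi_bmeas; have [mQ _] := Qop_bmeas pi P Lpi_bmeas.
apply: measurable_funD; first exact: measurable_funB.
apply: measurable_funM => //; apply: measurable_funB => //.
exact: measurable_funM.
Qed.

End value_function.

(** * Concentration of averages over independent trajectories *)

Section concentration.
Context {R : realType} {dS dA dO : measure_display} {S : measurableType dS}
  {A : measurableType dA} {Omega : measurableType dO}.
Variables (pi : R.-pker S ~> A) (P : R.-pker (S * A) ~> S)
  (rho : probability S R) (M T : nat) (Pr : probability Omega R)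
  (X : 'I_M -> nat -> Omega -> S) (f : S -> R) (c r : R).
Hypotheses (iidX : iid_trajectories Pr rho pi P T X) (M0 : (0 < M)%N)
  (T0 : (0 < T)%N) (mf : measurable_fun [set: S] f) (r0 : 0 < r)
  (fr : forall s, `|f s - c| <= r).

Local Notation EO g := (Rintegral Pr [set: Omega] g).

Let Pr1 : (Pr : {measure set Omega -> \bar R}) [set: Omega] = 1%E.
Proof. exact: probability_setT. Qed.

Let Y m w : R := T%:R^-1 * \sum_(1 <= t < T.+1) f (X m t w).
Let mean : R := T%:R^-1 * \sum_(1 <= t < T.+1) state_expect rho pi P t f.

Let bf : bmeas (`|c| + r) f.
Proof. exact: bmeas_center. Qed.

Let bfX m t : bmeas (`|c| + r) (fun w => f (X m t w)).
Proof. by apply: bmeas_comp => //; exact: iidX.1. Qed.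

Let Tn0 : T%:R != 0 :> R.
Proof. by rewrite pnatr_eq0 -lt0n. Qed.

Let Y_measurable m : measurable_fun [set: Omega] (Y m).
Proof.
apply: measurable_funM => //.
exact: (bmeas_sum (index_iota 1 T.+1) (fun t => bfX m t)).1.
Qed.

Let Y_center m w : `|Y m w - c| <= r.
Proof.
have -> : Y m w - c = T%:R^-1 * \sum_(1 <= t < T.+1) (f (X m t w) - c).
  rewrite sumrB sumr_const_nat subn1 /= -[c *+ _]mulr_natr mulrBr.
  by rewrite -/(Y m w); congr (_ - _); field.
have T1 : 0 <= T%:R^-1 :> R by rewrite invr_ge0.
rewrite normrM ger0_norm//.
have -> : r = T%:R^-1 * \sum_(1 <= t < T.+1) r.
  by rewrite sumr_const_nat subn1 /= -[r *+ _]mulr_natr; field.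
apply: ler_wpM2l => //; apply: (le_trans (ler_norm_sum _ _ _)).
exact: ler_sum.
Qed.

Let E_Y m : EO (Y m) = mean.
Proof.
have bs := bmeas_sum (index_iota 1 T.+1) (fun t => bfX m t).
have -> : Y m = fun w => T%:R^-1 * (\sum_(1 <= t < T.+1) f (X m t w)) + 0.
  by apply/funext => w; rewrite addr0.
rewrite (E_lin Pr1 _ bs (bmeas_cst 0)) (E_cst Pr1) addr0.
rewrite (E_sum Pr1 _ (fun t => bfX m t)) /mean; congr (_ * _).
by apply: eq_big_nat => t /andP[_ tT]; exact: (trajectory_E_state iidX _ _ bf).
Qed.

(** The time average starts at [t = 1], while the product formula also includes the initial state;
    that state gets the factor [1]. *)
Let expR_Y s m w : expR (s * Y m w) =
  \prod_(t < T.+1) (if t == 0 :> nat then 1 else expR (s / T%:R * f (X m t w))).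
Proof.
rewrite big_ord_recl /= mul1r /Y mulrA big_add1 big_mkord mulr_sumr expR_sum.
by [].
Qed.

Let mgf_sum s : EO (fun w => expR (s * \sum_(m < M) Y m w)) <=
  expR (M%:R * (s * mean + s ^+ 2 * r ^+ 2 / 2)).
Proof.
pose m0 := Ordinal M0.
pose g (t : nat) (x : S) : R := if t == 0 then 1 else expR (s / T%:R * f x).
pose K (t : nat) : R := if t == 0 then `|1| else expR (`|s / T%:R| * (`|c| + r)).
have bg t : bmeas (K t) (g t).
  rewrite /K /g; case: eqP => _; first exact: bmeas_cst.
  exact: bmeas_expR.
have -> : (fun w => expR (s * \sum_(m < M) Y m w)) =
    fun w => \prod_(m < M) \prod_(t < T.+1) g t (X m t w).
  apply/funext => w; rewrite mulr_sumr expR_sum; apply: eq_bigr => m _.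
  by rewrite expR_Y.
rewrite (trajectories_E_indep iidX m0 bg) expRM_natl.
apply: lerXn2r; rewrite ?nnegrE ?expR_ge0//.
  by apply: Rintegral_ge0 => w _; apply: prodr_ge0 => t _; rewrite /g; case: ifP.
rewrite -(E_Y m0).
apply: le_trans (hoeffding_mgf s Pr1 (Y_measurable m0) r0 (Y_center m0)).
rewrite le_eqVlt; apply/orP; left; apply/eqP.
by congr (Rintegral _ _ _); apply/funext => w; rewrite expR_Y.
Qed.

(** A two-sided Chernoff bound: the indicator of the event is dominated by a sum of two
    exponentials, one for each sign of the deviation, and each has expectation at most half the
    claimed bound. *)
Lemma trajectories_hoeffding (v alpha : R) :
  r ^+ 2 <= v / 2 -> 0 < v -> 0 < alpha ->
  (Pr [set w | (alpha <= `|M%:R^-1 *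
        \sum_(m < M) (T%:R^-1 * \sum_(1 <= t < T.+1) f (X m t w))
      - T%:R^-1 * \sum_(1 <= t < T.+1) state_expect rho pi P t f|)%R]
   <= (2 * expR (- (M%:R * alpha ^+ 2) / v))%:E)%E.
Proof.
move=> rv v0 a0.
pose SY w := \sum_(m < M) Y m w.
pose Z w := M%:R^-1 * SY w - mean.
pose F := [set w | alpha <= `|Z w|]; rewrite -/F.
(* The minimiser of [- s * alpha + s ^+ 2 * v / 4], the exponent per trajectory once [r ^+ 2] is
   replaced by [v / 2]; the minimum is [- alpha ^+ 2 / v]. *)
pose th : R := 2 * alpha / v.
have bY m : bmeas (`|c| + r) (Y m) by exact: bmeas_center.
have bSY := bmeas_sum (index_enum 'I_M) bY.
have mF : measurable F.
  rewrite -[F]setTI; apply: measurable_fun_ler => //.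
  apply: measurableT_comp => //; apply: measurable_funB => //.
  by apply: measurable_funM => //; exact: bSY.1.
have Mn0 : M%:R != 0 :> R by rewrite pnatr_eq0 -lt0n.
(* Normalised so that [G s w] is at least [1] as soon as [s * Z w] reaches [th * alpha]; it is used
   with [s = th] and [s = - th]. *)
pose k s : R := expR (- (M%:R * (s * mean + th * alpha))).
pose G s w := k s * expR (s * SY w).
have th0 : 0 <= th by rewrite divr_ge0 ?mulr_ge0 ?ltW.
have GE s w : G s w = expR (M%:R * (s * Z w - th * alpha)).
  by rewrite /G /k -expRD; congr expR; rewrite /Z; field.
have EG s : s ^+ 2 = th ^+ 2 -> k s * EO (fun w => expR (s * SY w)) <=
    expR (- (M%:R * alpha ^+ 2) / v).
  move=> s2; apply: (le_trans (ler_wpM2l (expR_ge0 _) (mgf_sum s))).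
  rewrite -expRD ler_expR s2.
  have -> : - (M%:R * alpha ^+ 2) / v =
      M%:R * (- th * alpha + th ^+ 2 * (v / 2) / 2).
    by rewrite /th; field; rewrite gt_eqF.
  have -> : - (M%:R * (s * mean + th * alpha)) +
      M%:R * (s * mean + th ^+ 2 * r ^+ 2 / 2) =
      M%:R * (- th * alpha + th ^+ 2 * r ^+ 2 / 2) by ring.
  rewrite ler_wpM2l// lerD2l ler_pM2r ?invr_gt0//.
  by rewrite ler_wpM2l ?sqr_ge0.
rewrite -(E_indic Pr1 mF) lee_fin.
have b1 : bmeas 1 (\1_F : Omega -> R) := bmeas_indic mF.
have bE s := bmeas_expR s bSY.
have bG2 := bmeas_lin (k (- th)) (bE (- th)) (bmeas_cst 0).
have bG := bmeas_lin (k th) (bE th) bG2.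
apply: (@le_trans _ _ (k th * EO (fun w => expR (th * SY w)) +
                      k (- th) * EO (fun w => expR (- th * SY w)))); last first.
  by rewrite [leRHS]mulr_natl mulr2n lerD// EG// sqrrN.
have EG2 := E_lin Pr1 (k th) (bE th) bG2.
rewrite [X in _ + X](E_lin Pr1 (k (- th)) (bE (- th)) (bmeas_cst 0)) in EG2.
rewrite (E_cst Pr1) addr0 in EG2; rewrite -EG2 => {EG2}.
apply: (le_E Pr1 b1 bG) => w; rewrite addr0 -/(G th w) -/(G (- th) w) indicE.
have [wF|_] := boolP (w \in F); last by rewrite addr_ge0 // GE expR_ge0.
have {wF} : alpha <= `|Z w| := set_mem wF.
rewrite !GE /= real_ler_normr ?num_real// => /orP[aZ|aZ].
  apply: ler_wpDr; first exact: expR_ge0.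
  by rewrite -expR0 ler_expR mulr_ge0// -mulrBr mulr_ge0// subr_ge0.
apply: ler_wpDl; first exact: expR_ge0.
by rewrite -expR0 ler_expR mulr_ge0// mulNr -mulrN -mulrBr mulr_ge0// subr_ge0.
Qed.

End concentration.

(** Both time averages run over [1 <= t <= T] with weight [T%:R^-1], so for positive [M] and [T] the
    subtracted term is the exact mean of the sample average and no bias has to be absorbed. The
    nondegenerate case is Hoeffding's bound with [v = q * H ^+ 2]. *)
Theorem theorem3 (R : realType) (dS dA dO : measure_display)
  (S : measurableType dS) (A : measurableType dA) (Omega : measurableType dO)
  (P : R.-pker (S * A) ~> S) (pi : R.-pker S ~> A) (C : S * A -> R)
  (rho : probability S R) (gamma k lam cbar : R) (M T : nat)
  (Pr : probability Omega R) (X : 'I_M -> nat -> Omega -> S) (alpha : R) :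
  measurable_fun [set: S * A] C ->
  (forall sa, 0 <= C sa) -> (forall sa, C sa <= cbar) ->
  0 < gamma < 1 ->
  iid_trajectories Pr rho pi P T X ->
  0 < alpha ->
  (Pr [set w | (alpha <= `| (M%:R * T%:R)^-1 *
        \sum_(m < M) \sum_(1 <= t < T.+1) DeltaL pi P C gamma k lam (X m t w)
      - T%:R^-1 * \sum_(1 <= t < T.+1)
          state_expect rho pi P t (DeltaL pi P C gamma k lam) |)%R ]
  <= ((2 : R) * expR (- (M%:R * alpha ^+ 2 * (1 - gamma) ^+ 2)
        / (((1 - k * lam) ^+ 2 + (k - 1) ^+ 2) * cbar ^+ 2)))%:E)%E.
Proof.
move=> mC C0 Cb g01 iidX a0.
have [_ g1] := andP g01.
set ev := [set w | _].
(* The inverse of [0] is [0], so for [T = 0] both averages vanish and the event is empty because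
   [alpha] is positive. *)
have [T0|T0] := posnP T.
  rewrite [ev](_ : _ = set0) ?measure0 ?lee_fin ?mulr_ge0 ?expR_ge0//.
  apply/seteqP; split => // w; rewrite /ev /=.
  by rewrite T0 invr0 mulr0 invr0 !mul0r subrr normr0 leNgt a0.
have mev : measurable ev.
  rewrite -[ev]setTI; apply: measurable_fun_ler => //.
  apply: measurableT_comp => //; apply: measurable_funB => //.
  apply: measurable_funM => //; apply: measurable_sum => m.
  apply: measurable_sum => t; apply: measurableT_comp; last exact: iidX.1.
  exact: DeltaL_measurable mC C0 Cb g01 k lam.
(* Division by zero gives exponent [0], and the bound [2] is then trivial. *)
have trivial_bound (x : R) : x = 0 -> (Pr ev <= ((2 : R) * expR x)%:E)%E.
  move=> ->; rewrite expR0 mulr1.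
  by apply: (le_trans (probability_le1 Pr mev)); rewrite lee_fin ler1n.
have [M0|M0] := posnP M.
  by apply: trivial_bound; rewrite M0 !mul0r oppr0 mul0r.
pose q := (1 - k * lam) ^+ 2 + (k - 1) ^+ 2; rewrite -/q.
have [qc0|qc0] := eqVneq (q * cbar ^+ 2) 0.
  by apply: trivial_bound; rewrite qc0 invr0 mulr0.
have g1' : 0 < 1 - gamma by rewrite subr_gt0.
pose H := cbar / (1 - gamma).
have q0 : 0 < q.
  rewrite lt_neqAle eq_sym addr_ge0 ?sqr_ge0// andbT.
  by apply: contraNneq qc0 => ->; rewrite mul0r.
have cbar_gt0 : 0 < cbar.
  rewrite lt_neqAle eq_sym; apply/andP; split.
    by apply: contraNneq qc0 => ->; rewrite expr0n mulr0.
  (* That [cbar] is nonnegative follows from its bounding the absolute value of the mean of [cpi]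
     under [rho]; no point of [S] has to be exhibited. *)
  have rho1 : (rho : {measure set S -> \bar R}) [set: S] = 1%E.
    exact: probability_setT.
  exact: le_trans (normr_ge0 _) (E_norm_le rho1 (cpi_bmeas pi mC C0 Cb)).
have H0 : 0 < H by rewrite divr_gt0.
pose r := (`|1 - k * lam| + `|k - 1|) * H / 2.
have r0 : 0 < r.
  rewrite divr_gt0// mulr_gt0// lt_neqAle eq_sym addr_ge0// andbT.
  rewrite paddr_eq0// !normr_eq0; apply: contraTN q0 => /andP[/eqP u0 /eqP v0].
  by rewrite /q u0 v0 expr0n addr0 ltxx.
(* The inequality [(x + y) ^+ 2 <= 2 * (x ^+ 2 + y ^+ 2)] trades the sum of absolute values for the
   sum of squares in the stated denominator. *)
have rv : r ^+ 2 <= q * H ^+ 2 / 2.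
  rewrite /r /q -(real_normK (num_real (1 - k * lam))).
  rewrite -(real_normK (num_real (k - 1))).
  move: `|1 - k * lam| `|k - 1| => x y.
  rewrite -subr_ge0.
  have -> : (x ^+ 2 + y ^+ 2) * H ^+ 2 / 2 - ((x + y) * H / 2) ^+ 2 =
      (H * (x - y) / 2) ^+ 2.
    by field.
  exact: sqr_ge0.
have v0 : 0 < q * H ^+ 2 by rewrite mulr_gt0// exprn_gt0.
have := trajectories_hoeffding iidX M0 T0
  (DeltaL_measurable pi P mC C0 Cb g01 k lam)
  r0 (DeltaL_center pi P mC C0 Cb g01 k lam) rv v0 a0.
have -> : - (M%:R * alpha ^+ 2) / (q * H ^+ 2) =
    - (M%:R * alpha ^+ 2 * (1 - gamma) ^+ 2) / (q * cbar ^+ 2).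
  by rewrite /H; field; rewrite !gt_eqF.
apply: le_trans; rewrite le_eqVlt; apply/orP; left; apply/eqP; congr (Pr _).
rewrite /ev; apply/funext => w /=.
by rewrite -mulr_sumr mulrA invfM.
Qed.
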